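(* Let $\phi:\mathbb{R}\to\mathbb{R}$ be an even, continuous, integrable function such that $\phi(0)=1$. In addition, suppose that its Fourier transform $\hat\phi$ is nonnegative, integrable and analytic on $\mathbb{R}$. Given $\lambda>0$, there exist a positive integer $n$ and $P\in E_n(\lambda)$ such that $$ \frac{\|P'\|_\infty}{\|P\|_\infty}\ \ge\ \frac{C}{\lambda}. $$ Here one can take $C=\pi^2/2^{10}$.
   Context: The Fourier transform of an integrable function $f$ on $\mathbb{R}$ is $\hat f(\omega)=\frac{1}{\sqrt{2\pi}}\int_{\mathbb{R}}f(x)e^{-i\omega x}\,dx$. For the given $\phi$, for $\lambda>0$ and a positive integer $n$, $$E_n(\lambda)=\Big\{\sum_{k=-n}^{n}b_k\,\phi(x+\lambda k)\ :\ b_k\in\mathbb{R},\ k=-n,\dots,-1,0,1,\dots,n\Big\},$$ a set of functions of $x\in\mathbb{R}$. $\|\cdot\|_\infty$ denotes the supremum norm on $\mathbb{R}$, and $P'$ is the derivative of $P$.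
   Formalization: The hypotheses do not make P differentiable (e.g. φ(x)=e^{-|x|}), so ‖P'‖_∞ is read as the supremum over x of |P'(x)| where P'(x) exists and of limsup_{h→0}|(P(x+h)-P(x))/h| elsewhere; for differentiable P this is the usual sup norm. *)

(* Defs.v *)
From HB Require Import structures.
From mathcomp Require Import all_boot all_order all_algebra.
From mathcomp Require Import all_classical all_reals all_analysis.
From mathcomp Require Import lra.
From mathcomp.real_closed Require Export complex.

Set Implicit Arguments.
Unset Strict Implicit.
Unset Printing Implicit Defensive.

Import Order.TTheory GRing.Theory Num.Theory.
Import numFieldNormedType.Exports.

Local Open Scope classical_set_scope.
Local Open Scope ring_scope.
Local Open Scope complex_scope.

Definition integrableR {R : realType} (f : R -> R) : Prop :=
  (@lebesgue_measure R).-integrable setT (EFin \o f).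

Definition integrableC {R : realType} (g : R -> R[i]) : Prop :=
  integrableR (fun x => complex.Re (g x)) /\
  integrableR (fun x => complex.Im (g x)).

Definition integralC {R : realType} (g : R -> R[i]) : R[i] :=
  (\int[@lebesgue_measure R]_x complex.Re (g x))
  +i* (\int[@lebesgue_measure R]_x complex.Im (g x)).

(* e^(i t) *)
Definition expi {R : realType} (t : R) : R[i] := cos t +i* sin t.

Definition fourier {R : realType} (f : R -> R) (w : R) : R[i] :=
  ((Num.sqrt (2 * pi))^-1)%:C *
  integralC (fun x => (f x)%:C * expi (- (w * x))).

Definition analyticR {R : realType} (f : R -> R) : Prop :=
  forall x0 : R, exists (r : R) (a : nat -> R), 0 < r /\
    forall x, `|x - x0| < r ->
      series (fun k => a k * (x - x0) ^+ k) @ \oo --> f x.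

(* Expanding real and imaginary parts separately amounts to a power series
   in the real variable with complex coefficients. *)
Definition analyticC {R : realType} (g : R -> R[i]) : Prop :=
  analyticR (fun x => complex.Re (g x)) /\
  analyticR (fun x => complex.Im (g x)).

(* The index i = 0, ..., 2n stands for k = i - n = -n, ..., n. *)
Definition E_ {R : realType} (phi : R -> R) (n : nat) (lambda : R) :
    set (R -> R) :=
  [set P | exists b : int -> R, forall x,
    P x = \sum_(i < (2 * n).+1)
            let k : int := i%:Z - n%:Z in b k * phi (x + lambda * k%:~R)].

Definition supnorm {R : realType} (f : R -> R) : \bar R :=
  ereal_sup (range (fun x => `|f x|%:E)).

Lemma limf_esup_derivable {R : realType} (P : R -> R) (x : R) : derivable P x 1 ->
  limf_esup (fun h => `|(P (x + h) - P x) / h|%:E) 0^' = `|derive1 P x|%:E.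
Proof.
rewrite derive1E; move=> dP.
have cv : (fun h => `|(P (x + h) - P x) / h|) @ 0^' --> `|'D_1 P x|.
  apply: cvg_norm.
  have -> : (fun h => (P (x + h) - P x) / h) = (fun h => h^-1 *: (P (h *: 1 + x) - P x)).
    by apply/funext => h; rewrite /GRing.scale /= mulr1 mulrC (addrC x).
  exact: dP.
set l := `|'D_1 P x| in cv *; set f := fun h => _ in cv *.
apply/eqP; rewrite eq_le; apply/andP; split.
- apply/lee_addgt0Pr => e e0; rewrite limf_esupE.
  apply: (@le_trans _ _ (ereal_sup ((fun h => (f h)%:E) @` [set h | f h <= l + e]))).
    apply: ereal_inf_lbound; exists [set h | f h <= l + e] => //.
    have /cvgrPdist_le /(_ e e0) := cv.
    by apply: filterS => h /= H; move: H; rewrite ler_distl => /andP[? ?]; lra.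
  by apply: ge_ereal_sup => _ [h /= H <-]; rewrite lee_fin.
- rewrite limf_esupE; apply: le_ereal_inf_tmp => _ [V FV <-].
  apply/lee_subgt0Pr => e e0.
  have /cvgrPdist_le /(_ e e0) cv' := cv.
  have [h [Vh H]] : exists h, V h /\ `|l - f h| <= e.
    exact: (@filter_ex _ (0^' : set_system R) _ (fun h => V h /\ _) (filterI FV cv')).
  apply: (@le_trans _ _ (f h)%:E); last by apply: ereal_sup_ubound; exists h.
  by rewrite -EFinB lee_fin; move: H; rewrite ler_distl => /andP[? ?]; lra.
Qed.

(* |P'(x)|.  An element of E_n(lambda) need not be differentiable everywhere
   (take phi(x) = exp(-|x|)), so at the points where P'(x) does not exist we
   use the upper limit of |(P(x + h) - P(x)) / h| as h -> 0, which
   equals |P'(x)| wherever P'(x) exists (limf_esup_derivable). *)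
Definition abs_deriv {R : realType} (P : R -> R) (x : R) : \bar R :=
  if `[< derivable P x 1 >] then `|derive1 P x|%:E
  else limf_esup (fun h => `|(P (x + h) - P x) / h|%:E) 0^'.

(* ||P'||_oo; see deriv_supnormE for everywhere differentiable P. *)
Definition deriv_supnorm {R : realType} (P : R -> R) : \bar R :=
  ereal_sup (range (abs_deriv P)).

Lemma deriv_supnormE {R : realType} (P : R -> R) :
  (forall x, derivable P x 1) -> deriv_supnorm P = supnorm (derive1 P).
Proof.
move=> dP; rewrite /deriv_supnorm /supnorm.
suff -> : abs_deriv P = (fun x => `|derive1 P x|%:E) by [].
by apply/funext => x; rewrite /abs_deriv asboolT.
Qed.

(* Main.v *)
Require Import Defs.
From mathcomp Require Import all_boot all_order all_algebra.
From mathcomp Require Import all_classical all_reals all_analysis.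
From mathcomp Require Import measurable_realfun zify ring lra.
Import Order.TTheory GRing.Theory Num.Theory.
Import numFieldNormedType.Exports.
Local Open Scope classical_set_scope.
Local Open Scope ring_scope.

(** Since [phi] is continuous and integrable and its Fourier transform is
    nonnegative and integrable, Abel summation of the inversion formula (the
    Poisson kernel is an approximate identity) gives
    [phi x = \int_(w >= 0) g w * cos (w * x)] with [g >= 0] a multiple of the
    Fourier transform.  Let [T f x = f x - (f (x + l) + f (x - l)) / 2] and
    [P m = T^m phi], an element of [E_m(l)].  Then
    [P m x = \int g w * (1 - cos (w * l))^m * cos (w * x)], so that
    [|P m x| <= P m 0], and [P m.+1 0 = P m 0 - P m l].  Where
    [cos (w * l) <= 0] the weight [(1 - cos (w * l))^m] is at least 1, so
    [P m 0 >= J], where [J] is the integral of [g] over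
    [[pi / (2 l), 3 pi / (2 l)]]; and [J > 0], as an analytic function whose
    zeros cluster vanishes identically.  Hence the sequence [P m 0] cannot
    decrease at each step by a factor 4, and an [m] with
    [P m.+1 0 >= P m 0 / 4] satisfies [P m 0 - P m l >= P m 0 / 4], which the
    mean value inequality turns into [||P'|| >= ||P|| / (4 l)]; and
    [pi^2 / 2^10 < 1 / 4]. *)

(** * Mean value inequality for upper derivates *)

(** The radius [d] depends on [x], so the local bounds are glued by a supremum argument. The local
    bound at [t = sup S], applied to the left, puts [t] in [S]; applied to the right, it extends [S]
    beyond [t] unless [t = b]. *)
Lemma dini_mean_value {R : realType} (P : R -> R) (L a b : R) : a <= b ->
  (forall x, exists2 d : R, 0 < d &
    forall h, `|h| < d -> `|P (x + h) - P x| <= L * `|h|) ->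
  `|P b - P a| <= L * (b - a).
Proof.
move=> ab lipP.
pose S := [set t | a <= t <= b /\ `|P t - P a| <= L * (t - a)].
have Sa : S a by split; [lra | rewrite !subrr normr0 mulr0].
have ubS : has_ubound S by exists b => t [/andP[]].
have [t tE] : exists t, sup S = t by exists (sup S).
have at_ : a <= t by rewrite -tE; exact: ub_le_sup Sa.
have tb : t <= b by rewrite -tE; apply: ge_sup; [exists a | move=> s [/andP[]]].
have [d d0 lipd] := lipP t.
have St : S t.
  (* Choose [s] in [S] within [d] of [t] and apply the local bound at [t] with the nonpositive
     increment [s - t]. *)
  split; first by rewrite at_ tb.
  have [s Ss sd] := sup_adherent d0 (conj (ex_intro _ a Sa) ubS).
  rewrite tE in sd.
  have st : s <= t by rewrite -tE; exact: ub_le_sup Ss.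
  have [/andP[as_ sb] Ps] := Ss.
  have : `|s - t| < d by rewrite ler0_norm; lra.
  move=> /lipd; rewrite subrKC [`|s - t|]ler0_norm; last by lra.
  move=> H.
  rewrite (_ : P t - P a = (P s - P a) - (P s - P t)); last by ring.
  by apply: (le_trans (ler_normB _ _)); lra.
have [<-|tneb] := eqVneq t b; first by case: St.
have tltb : t < b by rewrite lt_neqAle tneb.
pose h := Num.min (d / 2) (b - t).
have h0 : 0 < h by rewrite lt_min; apply/andP; split; lra.
have hd : h < d by rewrite gt_min; apply/orP; left; lra.
have hb : h <= b - t by rewrite ge_min lexx orbT.
suff /(ub_le_sup ubS) : S (t + h) by rewrite tE; lra.
split; first by lra.
have := lipd h; rewrite gtr0_norm// => /(_ hd) H.
case: St => _ Pt.
rewrite (_ : _ - P a = (P (t + h) - P t) + (P t - P a)); last by ring.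
by apply: (le_trans (ler_normD _ _)); lra.
Qed.

Lemma abs_derivE {R : realType} (P : R -> R) (x : R) :
  abs_deriv P x = limf_esup (fun h => `|(P (x + h) - P x) / h|%:E) 0^'.
Proof.
rewrite /abs_deriv; case: asboolP => // dP.
by rewrite limf_esup_derivable.
Qed.

(** Strictness matters: an upper limit below [L] forces the difference quotients below [L] on a
    punctured neighbourhood of each point, which is the local hypothesis of [dini_mean_value]. This
    replaces the mean value theorem where [P] may fail to be differentiable. *)
Lemma lipschitz_deriv_supnorm {R : realType} (P : R -> R) (L : R) :
  (deriv_supnorm P < L%:E)%E ->
  forall a b, a <= b -> `|P b - P a| <= L * (b - a).
Proof.
move=> PL a b ab; apply: dini_mean_value => // x.
have : (abs_deriv P x < L%:E)%E.
  by apply: le_lt_trans PL; apply: ereal_sup_ubound; exists x.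
rewrite abs_derivE limf_esupE => /ereal_inf_lt[_ [V /= V0 <-] supV].
have [/= d d0 dV] := (nbhs_ballP _ _).1 V0.
exists d => // h hd.
have [->|hn0] := eqVneq h 0; first by rewrite addr0 subrr normr0 mulr0.
have : (`|(P (x + h) - P x) / h|%:E < L%:E)%E.
  apply: le_lt_trans supV; apply: ereal_sup_ubound; exists h => //.
  by apply: dV => //; rewrite /ball/= sub0r normrN.
by rewrite lte_fin normf_div ltr_pdivrMr ?normr_gt0// => /ltW.
Qed.

(** * Zeros of real analytic functions *)

Lemma pseries_term_bounded {R : realType} (a : nat -> R) (rho l : R) :
  series (fun k => a k * rho ^+ k) @ \oo --> l ->
  exists2 M : R, 0 < M & forall k, `|a k * rho ^+ k| <= M.
Proof.
move=> al.
have a0 : (fun k => a k * rho ^+ k) @ \oo --> (0 : R^o).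
  by apply: cvg_series_cvg_0; apply/cvg_ex; exists l.
have /cvg_seq_bounded [M [Mr HM]] : cvgn ((fun k => a k * rho ^+ k) : R^o ^nat).
  by apply/cvg_ex; exists 0.
exists (`|M| + 1); first by rewrite ltr_wpDl.
by move=> k; apply: (HM (`|M| + 1)) => //; rewrite ltr_pwDr// ler_norm.
Qed.

(** The terms after the [k]-th are dominated by [M * q ^+ j] with [q = |t| / rho <= 1 / 2], a
    geometric tail of sum at most [2 * M * q ^+ k.+1]. *)
Lemma pseries_leading_term {R : realType} (a : nat -> R) (rho M t s : R) k :
  0 < rho -> `|t| <= rho / 2 -> (forall k, `|a k * rho ^+ k| <= M) ->
  (forall j, (j < k)%N -> a j = 0) ->
  series (fun k => a k * t ^+ k) @ \oo --> s ->
  `|s - a k * t ^+ k| <= 2 * M * (`|t| / rho) ^+ k.+1.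
Proof.
move=> rho0 t2 aM ak s_.
pose q := `|t| / rho; rewrite -/q.
have q0 : 0 <= q by rewrite divr_ge0// ltW.
have q2 : q <= 1 / 2 by rewrite ler_pdivrMr//; lra.
have M0 : 0 <= M by exact: le_trans (aM 0%N).
have term n : `|a n * t ^+ n| <= M * q ^+ n.
  rewrite normrM normrX (_ : `|t| = rho * q); last first.
    by rewrite /q mulrC divfK// gt_eqF.
  rewrite exprMn mulrA ler_wpM2r ?exprn_ge0//.
  by have := aM n; rewrite normrM normrX (gtr0_norm rho0).
(* The factor [2 - 2 * (1 / 2) ^+ n] is the sum of the first [n] powers of 1/2, a form that makes
   the induction close. *)
have partial n : `|series (fun k => a k * t ^+ k) (k.+1 + n)%N - a k * t ^+ k|
    <= M * q ^+ k.+1 * (2 - 2 * (1 / 2) ^+ n).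
  elim: n => [|n IH].
    rewrite addn0 /series/= big_nat_recr//= big_nat_cond big1 => [|i].
      by rewrite add0r subrr normr0 expr0 mulr1 subrr mulr0.
    by rewrite andbT => /andP[_ ik]; rewrite ak// mul0r.
  rewrite addnS seriesSr [X in X <= _](_ : _ =
    `|(series (fun k => a k * t ^+ k) (k.+1 + n)%N - a k * t ^+ k) +
      a (k.+1 + n)%N * t ^+ (k.+1 + n)|); last by congr `|_|; ring.
  apply: (le_trans (ler_normD _ _)).
  have : M * q ^+ (k.+1 + n) <= M * q ^+ k.+1 * (1 / 2) ^+ n.
    rewrite exprD mulrA; apply: ler_wpM2l; first by rewrite mulr_ge0// exprn_ge0.
    by apply: lerXn2r => //; rewrite nnegrE; lra.
  have := term (k.+1 + n)%N; have -> : (1 / 2 : R) ^+ n.+1 = 1 / 2 * (1 / 2) ^+ n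
    by rewrite exprS.
  by move: IH; lra.
have B0 : 0 <= M * q ^+ k.+1 by rewrite mulr_ge0// exprn_ge0.
have : series (fun k => a k * t ^+ k) n - a k * t ^+ k @[n --> \oo] -->
   s - a k * t ^+ k by apply: cvgB => //; exact: cvg_cst.
move/cvg_norm => /(_ _) H; rewrite (_ : 2 * M * _ = M * q ^+ k.+1 * 2); last by ring.
apply: (cvgr_to_le H); exists k.+1 => // n /= kn.
have := partial (n - k.+1)%N; rewrite subnKC//= => /le_trans; apply.
apply: ler_wpM2l => //.
have : 0 <= (1 / 2 : R) ^+ (n - k.+1) by apply: exprn_ge0; lra.
lra.
Qed.

(** If [a k] is the first nonzero coefficient at [x0], the leading term dominates the rest near
    [x0], so no other zero can be arbitrarily close. Hence all coefficients vanish. *)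
Lemma analytic_clustering_zeros {R : realType} (f : R -> R) (x0 : R) :
  analyticR f ->
  (forall e : R, 0 < e -> exists x, [/\ x != x0, `|x - x0| < e & f x = 0]) ->
  exists2 r : R, 0 < r & forall x, `|x - x0| < r -> f x = 0.
Proof.
move=> /(_ x0)[r [a [r0 fa]]] zeros.
have rho0 : 0 < r / 2 by lra.
have [M M0 aM] : exists2 M : R, 0 < M & forall k, `|a k * (r / 2) ^+ k| <= M.
  apply: (@pseries_term_bounded _ a _ (f (x0 + r / 2))).
  have := fa (x0 + r / 2); rewrite (addrC x0) addrK; apply.
  by rewrite gtr0_norm//; lra.
suff a0 k : a k = 0.
  exists r => // x /fa fx; rewrite -(cvg_lim _ fx)//; apply: cvg_lim => //.
  apply: cvg_near_cst; apply: nearW => n.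
  by rewrite /series/= big1// => i _; rewrite a0 mul0r.
elim/ltn_ind: k => k IH; apply/eqP/negPn/negP => ak.
pose c := `|a k| * (r / 2) ^+ k.
have c0 : 0 < c by rewrite mulr_gt0 ?normr_gt0// exprn_gt0.
(* The first bound gives [|x - x0| <= rho / 2] for [rho = r / 2]. The second gives
   [q < c / (4 * M)], whereas a zero at [x] would force [c <= 2 * M * q]. *)
have d0 : 0 < Num.min (r / 4) (r / 2 * (c / (4 * M))).
  rewrite lt_min; apply/andP; split; first by lra.
  by apply: mulr_gt0 => //; apply: divr_gt0 => //; lra.
have [x [xx0]] := zeros _ d0.
rewrite lt_min => /andP[x1 x2] fx.
have tpos : 0 < `|x - x0| by rewrite normr_gt0 subr_eq0.
have tr : `|x - x0| <= r / 2 / 2 by lra.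
have /fa fx_ : `|x - x0| < r by lra.
have := @pseries_leading_term _ a (r / 2) M (x - x0) (f x) k rho0 tr aM IH fx_.
set q := _ / (r / 2).
have qpos : 0 < q by rewrite divr_gt0.
have tq : `|x - x0| = r / 2 * q by rewrite /q mulrC divfK// gt_eqF.
rewrite fx sub0r normrN normrM normrX tq exprMn mulrA -/c exprSr mulrA.
rewrite [_ * q ^+ k * q]mulrAC ler_pM2r ?exprn_gt0//.
move: x2; rewrite tq ltr_pM2l// ltr_pdivlMr; last by lra.
lra.
Qed.

(** The points around which [f] vanishes form a nonempty, open and closed set, and the line is
    connected. *)
Lemma analytic_zero_locus {R : realType} (f : R -> R) (x0 : R) :
  analyticR f ->
  (forall e : R, 0 < e -> exists x, [/\ x != x0, `|x - x0| < e & f x = 0]) ->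
  forall x, f x = 0.
Proof.
move=> anf zeros.
pose B := [set x | exists2 r : R, 0 < r & forall y, `|y - x| < r -> f y = 0].
have BE : B = setT.
  have : connected [set: R] by apply/connected_intervalP.
  apply.
  - by exists x0; exact: analytic_clustering_zeros.
  - exists B; rewrite ?setTI// openE => x [r r0 fr].
    apply/nbhs_ballP; exists (r / 2) => /=; first by lra.
    move=> y /=; rewrite /ball/= => xy; exists (r / 2); first by lra.
    move=> z zy; apply: fr; rewrite (_ : z - x = (z - y) - (x - y)); last by ring.
    by apply: (le_lt_trans (ler_normB _ _)); lra.
  (* For closedness, a limit point outside [B] is approached by points of [B], which are zeros
     distinct from it; clustering then puts it in [B] after all. *)
  - exists B; rewrite ?setTI//; apply/closure_id/seteqP; split.
      exact: subset_closure.
    move=> x clx; apply: contrapT => nBx; apply: (nBx).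
    apply: analytic_clustering_zeros => // e e0.
    have [y [By yx]] := clx _ (nbhsx_ballx x e e0).
    exists y; split.
    + by apply: contra_notN nBx => /eqP <-.
    + by rewrite distrC.
    + by case: By => r r0; apply; rewrite subrr normr0.
move=> x; have [r r0] : B x by rewrite BE.
by apply; rewrite subrr normr0.
Qed.

(** * Fourier inversion by Abel summation *)

Lemma norm_cos_le1 {R : realType} (t : R) : `|cos t| <= 1.
Proof. by rewrite ler_norml cos_geN1 cos_le1. Qed.

Lemma norm_sin_le1 {R : realType} (t : R) : `|sin t| <= 1.
Proof. by rewrite ler_norml sin_geN1 sin_le1. Qed.

(** The factor [1 / pi] is left out, so the total mass is [pi]. *)
Definition poisson {R : realType} (e t : R) : R := e / (e ^+ 2 + t ^+ 2).

Lemma cvg_expR_oppM {R : realType} (e : R) : 0 < e ->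
  expR (- e * w) @[w --> +oo] --> 0.
Proof.
move=> e0.
have -> : (fun w => expR (- e * w)) = (fun u => expR (- u)) \o (fun w => e * w).
  by apply/funext => w /=; rewrite mulNr.
apply: cvg_comp (@cvgr_expR R).
exact: gt0_cvgMry.
Qed.

(** Adding 1 to the cosine makes the integrand nonnegative, as the fundamental theorem of calculus
    on a half-line for nonnegative functions requires. The extra term is removed in
    [Rintegral_expR_cos]. *)
Lemma integral_expR_onePcos {R : realType} (e t : R) : 0 < e ->
  (\int[@lebesgue_measure R]_(w in `[0%R, +oo[)
     (expR (- e * w) * (1 + cos (w * t)))%:E = (e^-1 + poisson e t)%:E)%E.
Proof.
move=> e0.
have et0 : e ^+ 2 + t ^+ 2 != 0.
  by rewrite gt_eqF// ltr_pwDl ?exprn_gt0// sqr_ge0.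
(* An explicit antiderivative that tends to 0 at infinity, so the integral is [- F 0]. *)
pose F (w : R) :=
  expR (- e * w) * (- e^-1 + (t * sin (w * t) - e * cos (w * t)) / (e ^+ 2 + t ^+ 2)).
pose f (w : R) := expR (- e * w) * (1 + cos (w * t)).
have dF (w : R) : is_derive w 1 F (f w).
  apply: is_derive_eq.
  rewrite /f /GRing.scale/=.
  by field; rewrite et0 gt_eqF.
have cf : continuous f.
  move=> w; apply/differentiable_continuous/derivable1_diffP.
  by apply: ex_derive.
have F0 : F w @[w --> +oo] --> 0.
  have bnd (w : R) : `|F w| <= (e^-1 + (`|t| + e) / (e ^+ 2 + t ^+ 2)) * expR (- e * w).
    rewrite /F normrM ger0_norm ?expR_ge0// mulrC ler_wpM2r ?expR_ge0//.
    apply: (le_trans (ler_normD _ _)); rewrite normrN gtr0_norm ?invr_gt0// lerD2l.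
    have S0 : 0 < e ^+ 2 + t ^+ 2 by rewrite ltr_pwDl ?exprn_gt0// sqr_ge0.
    have SV0 : 0 < (e ^+ 2 + t ^+ 2)^-1 by rewrite invr_gt0.
    rewrite normrM (gtr0_norm SV0) ler_pM2r//.
    apply: (le_trans (ler_normB _ _)); rewrite !normrM (gtr0_norm e0) lerD//.
      by apply: ler_piMr; rewrite ?norm_sin_le1.
    by apply: ler_piMr; rewrite ?norm_cos_le1 ?ltW.
  apply: norm_cvg0; apply: (@squeeze_cvgr _ _ _ _ (cst 0)
    (fun w => (e^-1 + (`|t| + e) / (e ^+ 2 + t ^+ 2)) * expR (- e * w))).
  - by apply: nearW => w; rewrite /= normr_ge0 bnd.
  - exact: cvg_cst.
  - rewrite -[X in _ --> X](mulr0 (e^-1 + (`|t| + e) / (e ^+ 2 + t ^+ 2))).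
    by apply: cvgM; [exact: cvg_cst | exact: cvg_expR_oppM].
rewrite (@ge0_continuous_FTC2y _ f F 0 0) //.
- rewrite -EFinB /F !(mulr0, mul0r) expR0 sin0 cos0; congr (_%:E).
  rewrite /poisson; field.
  by rewrite et0 gt_eqF.
- move=> w _; apply: mulr_ge0; first exact: expR_ge0.
  by have := cos_geN1 (w * t); lra.
- exact: continuous_subspaceT.
- apply: cvg_at_right_filter; apply/differentiable_continuous/derivable1_diffP.
  by case: (dF 0).
- by move=> w _; rewrite derive1E; case: (dF w).
Qed.

Lemma integrable_mul_bounded {R : realType} (D : set R) (f g : R -> R) :
  measurable D ->
  (@lebesgue_measure R).-integrable D (EFin \o f) ->
  measurable_fun setT g -> (forall x, `|g x| <= 1) ->
  (@lebesgue_measure R).-integrable D (EFin \o (fun x => f x * g x)).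
Proof.
move=> mD fi mg g1.
apply: (le_integrable _ _ _ fi) => //.
  have /measurable_EFinP mf := measurable_int _ fi.
  apply/measurable_EFinP/measurable_funM => //.
  exact: measurable_funTS.
by move=> x Dx; rewrite /= lee_fin normrM ler_piMr.
Qed.

Lemma measurable_cosM {R : realType} (t : R) :
  measurable_fun setT (fun w : R => cos (w * t)).
Proof.
apply: continuous_measurable_fun => w.
by apply: continuous_comp; [exact: mulrr_continuous | exact: continuous_cos].
Qed.

Lemma measurable_sinM {R : realType} (t : R) :
  measurable_fun setT (fun w : R => sin (w * t)).
Proof.
apply: continuous_measurable_fun => w.
by apply: continuous_comp; [exact: mulrr_continuous | exact: continuous_sin].
Qed.

Lemma integrable_expR_oppM {R : realType} (e : R) : 0 < e ->
  (@lebesgue_measure R).-integrable `[0, +oo[ (EFin \o (fun w => expR (- e * w))).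
Proof.
move=> e0.
have mexp : measurable_fun setT (fun w => expR (- e * w)).
  by apply: measurableT_comp => //; exact: mulrl_measurable.
have gi : (@lebesgue_measure R).-integrable `[0, +oo[
    (fun w => (expR (- e * w) * (1 + cos (w * 0)))%:E).
  apply/integrableP; split.
    apply/measurable_EFinP; apply: measurable_funTS; apply: measurable_funM => //.
    by apply: measurable_funD => //; exact: measurable_cosM.
  under eq_integral => w _.
    rewrite gee0_abs; last first.
      rewrite lee_fin; apply: mulr_ge0; first exact: expR_ge0.
      by rewrite mulr0 cos0; lra.
    over.
  by rewrite integral_expR_onePcos// ltry.
apply: (le_integrable _ _ _ gi) => //.
  by apply/measurable_EFinP; exact: measurable_funTS.
move=> w _ /=; rewrite lee_fin mulr0 cos0 normrM ler_peMr//.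
by rewrite ger0_norm; lra.
Qed.

Lemma Rintegral_expR_cos {R : realType} (e t : R) : 0 < e ->
  \int[@lebesgue_measure R]_(w in `[0, +oo[) (expR (- e * w) * cos (w * t)) =
  poisson e t.
Proof.
move=> e0.
have ei := integrable_expR_oppM _ e0.
have eci t' : (@lebesgue_measure R).-integrable `[0, +oo[
    (EFin \o (fun w => expR (- e * w) * cos (w * t'))).
  apply: integrable_mul_bounded => //; first exact: measurable_cosM.
  by move=> x; exact: norm_cos_le1.
have H t' : \int[@lebesgue_measure R]_(w in `[0, +oo[) expR (- e * w) +
   \int[@lebesgue_measure R]_(w in `[0, +oo[) (expR (- e * w) * cos (w * t')) =
   e^-1 + poisson e t'.
  rewrite -RintegralD//.
  under eq_Rintegral => w _ do rewrite -[X in X + _]mulr1 -mulrDr.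
  by rewrite /Rintegral integral_expR_onePcos.
(* At [t' = 0] both integrals coincide and [poisson e 0 = e^-1], so the plain exponential integrates
   to [e^-1]; subtracting it leaves the cosine part. *)
have := H 0; under [X in _ + X]eq_Rintegral => w _ do rewrite mulr0 cos0 mulr1.
rewrite /poisson expr0n addr0 expr2 invfM mulrA divff ?gt_eqF// mul1r => H0.
apply: (@addrI _ e^-1); rewrite -H; congr (_ + _); apply/esym.
move: H0; set I := Rintegral _ _ _; move: I (e^-1) => I i; clear; lra.
Qed.

Lemma integral_oneDsqrV {R : realType} :
  (\int[@lebesgue_measure R]_x ((oneDsqr x)^-1)%:E = (pi : R)%:E)%E.
Proof.
have mf : measurable_fun setT (fun x : R => ((oneDsqr x)^-1)%:E).
  apply/measurable_EFinP; apply: continuous_measurable_fun.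
  exact: continuous_oneDsqrV.
have f0 (x : R) : (0 <= ((oneDsqr x)^-1)%:E)%E.
  by rewrite lee_fin invr_ge0 ltW// oneDsqr_gt0.
have half := @ge0_integration_by_substitution0 R _ mf f0.
rewrite -(setUv `[0%R, +oo[%classic) ge0_integral_setU//=; last first.
- by rewrite disj_set2E; apply/eqP; rewrite setICr.
- exact: measurable_funTS.
- exact/measurableC.
rewrite integral0y_oneDsqr setCitvr.
have -> : (\int[@lebesgue_measure R]_(x in `]-oo, 0%R[) ((oneDsqr x)^-1)%:E =
    \int[@lebesgue_measure R]_(x in `]-oo, 0%R]) ((oneDsqr (- x))^-1)%:E)%E.
  rewrite integral_itv_bndo_bndc; last exact: measurable_funTS.
  by apply: eq_integral => x _; rewrite /oneDsqr sqrrN.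
rewrite -half integral0y_oneDsqr -EFinD; congr (_%:E); lra.
Qed.

Lemma integral_poisson {R : realType} (e x : R) : 0 < e ->
  (\int[@lebesgue_measure R]_y (poisson e (x - y))%:E = (pi : R)%:E)%E.
Proof.
move=> e0; rewrite -integral_oneDsqrV.
have dF (y : R) : is_derive y 1 (fun y => (y - x) / e) e^-1.
  by apply: is_derive_eq; rewrite /GRing.scale/=; ring.
have F'E : derive1 (fun y : R => (y - x) / e) = cst e^-1.
  by apply/funext => y; rewrite derive1E; case: (dF y).
have pE (y : R) : poisson e (x - y) = (oneDsqr ((y - x) / e))^-1 * e^-1.
  rewrite /poisson /oneDsqr.
  have S0 : 0 < e ^+ 2 + (x - y) ^+ 2 by rewrite ltr_pwDl ?exprn_gt0// sqr_ge0.
  have -> : 1 + ((y - x) / e) ^+ 2 = (e ^+ 2 + (x - y) ^+ 2) / e ^+ 2.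
    by field; rewrite gt_eqF.
  by field; rewrite gt_eqF//= gt_eqF.
rewrite (@increasing_ge0_integration_by_substitutionT _ (fun y => (y - x) / e)
  (fun u => (oneDsqr u)^-1)).
- apply: eq_integral => y _; rewrite F'E; congr (_%:E).
  exact: pE.
- by move=> a b ab; rewrite ltr_pM2r ?invr_gt0// ltrD2r.
- by rewrite F'E; exact: cst_continuous.
- by rewrite F'E; exact: is_cvg_cst.
- by rewrite F'E; exact: is_cvg_cst.
- by move=> y; exact: ex_derive.
- apply: gt0_cvgMlNy; first by rewrite invr_gt0.
  exact: cvg_addrr_Ny.
- apply: gt0_cvgMly; first by rewrite invr_gt0.
  exact: cvg_addrr.
- exact: continuous_oneDsqrV.
- by move=> y; rewrite invr_ge0 ltW// oneDsqr_gt0.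
Qed.

Lemma integrableR_lty {R : realType} (f : R -> R) : integrableR f ->
  (\int[@lebesgue_measure R]_x `|f x|%:E < +oo)%E.
Proof. by move=> /integrableP[]. Qed.

(** The kernel is bounded by [|h w| * |f y|], which is integrable on the plane, so Fubini
    applies. *)
Lemma Rintegral_Fubini_cos {R : realType} (h f : R -> R) (x : R) :
  integrableR h -> integrableR f ->
  \int[@lebesgue_measure R]_w
     (h w * \int[@lebesgue_measure R]_y (f y * cos (w * (x - y)))) =
  \int[@lebesgue_measure R]_y
     (f y * \int[@lebesgue_measure R]_w (h w * cos (w * (x - y)))).
Proof.
move=> hi fi.
have fci w : integrableR (fun y => f y * cos (w * (x - y))).
  apply: integrable_mul_bounded => //; last by move=> y; exact: norm_cos_le1.
  apply: (measurableT_comp (continuous_measurable_fun (@continuous_cos R))).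
  by apply: measurable_funM => //; exact: measurable_funB.
have hci y : integrableR (fun w => h w * cos (w * (x - y))).
  apply: integrable_mul_bounded => //; last by move=> w; exact: norm_cos_le1.
  exact: measurable_cosM.
pose k (z : R * R) := (h z.1 * (f z.2 * cos (z.1 * (x - z.2)))).
have /measurable_EFinP mh := measurable_int _ hi.
have /measurable_EFinP mf := measurable_int _ fi.
have mk : measurable_fun setT (EFin \o k).
  apply/measurable_EFinP; apply: measurable_funM.
    by apply: measurableT_comp.
  apply: measurable_funM.
    by apply: measurableT_comp.
  apply: (measurableT_comp (continuous_measurable_fun (@continuous_cos R))).
  by apply: measurable_funM => //; exact: measurable_funB.
have ki : (@lebesgue_measure R \x @lebesgue_measure R)%E.-integrable setT (EFin \o k).
  apply/integrable12ltyP => //.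
  apply: (@le_lt_trans _ _ (\int[@lebesgue_measure R]_w
     ((\int[@lebesgue_measure R]_y `|f y|%:E) * `|h w|%:E))%E); last first.
    rewrite ge0_integralZl//; last 2 first.
    - by apply/measurable_EFinP; exact: measurableT_comp.
    - exact: integral_ge0.
    apply: lte_mul_pinfty; first exact: integral_ge0.
      rewrite ge0_fin_numE; first exact: integrableR_lty.
      exact: integral_ge0.
    exact: integrableR_lty.
  apply: ge0_le_integral => //.
  - by move=> w _; exact: integral_ge0.
  - have mak : measurable_fun setT (abse \o (EFin \o k)).
      exact: measurableT_comp.
    exact: (measurable_fun_fubini_tonelli_F (m2 := @lebesgue_measure R) _ mak
      (fun z => abse_ge0 _)).
  - apply: emeasurable_funM => //.
    by apply/measurable_EFinP; exact: measurableT_comp.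
  move=> w _; rewrite muleC -ge0_integralZl//; last first.
    by apply/measurable_EFinP; exact: measurableT_comp.
  apply: ge0_le_integral => //.
  - have mfc : measurable_fun setT (fun y => f y * cos (w * (x - y))).
      by apply/measurable_EFinP; exact: (measurable_int _ (fci w)).
    apply/measurable_EFinP; apply: measurableT_comp => //.
    exact: (measurable_funM (measurable_cst (h w)) mfc).
  - apply: emeasurable_funM => //.
    by apply/measurable_EFinP; exact: measurableT_comp.
  move=> y _; rewrite -EFinM lee_fin /k/= !normrM ler_wpM2l//.
  by rewrite ler_piMr// norm_cos_le1.
have := @Fubini _ _ _ _ _ _ _ _ ki.
rewrite /Rintegral => E; congr fine.
transitivity (\int[@lebesgue_measure R]_w \int[@lebesgue_measure R]_y
   ((EFin \o k) (w, y)))%E.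
  apply: eq_integral => w _; rewrite EFinM fineK; last first.
    by apply: integrable_fin_num => //; exact: fci.
  by rewrite -integralZl//; exact: fci.
rewrite E; apply: eq_integral => y _; rewrite EFinM fineK; last first.
  by apply: integrable_fin_num => //; exact: hci.
rewrite -integralZl//; last exact: hci.
by apply: eq_integral => w _; rewrite /k/= mulrCA.
Qed.

Lemma poisson_ge0 {R : realType} (e t : R) : 0 <= e -> 0 <= poisson e t.
Proof. by move=> e0; rewrite divr_ge0// addr_ge0 ?sqr_ge0. Qed.

Lemma poisson_le {R : realType} (e t : R) : 0 < e -> poisson e t <= e^-1.
Proof.
move=> e0; have e20 : 0 < e ^+ 2 by rewrite exprn_gt0.
have et0 : 0 < e ^+ 2 + t ^+ 2 by rewrite ltr_pwDl// sqr_ge0.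
by rewrite /poisson ler_pdivrMr// ler_pdivlMl// -expr2 lerDl sqr_ge0.
Qed.

Lemma measurable_poisson {R : realType} (e x : R) : 0 < e ->
  measurable_fun setT (fun y : R => poisson e (x - y)).
Proof.
move=> e0; apply: continuous_measurable_fun => y.
have cden : continuous (fun z : R => e ^+ 2 + (x - z) ^+ 2).
  by move=> z; apply/differentiable_continuous/derivable1_diffP; exact: ex_derive.
rewrite /poisson; apply: cvgM; first exact: cvg_cst.
apply: cvgV; first by rewrite gt_eqF// ltr_pwDl ?exprn_gt0// sqr_ge0.
exact: cden.
Qed.

Lemma integrable_poisson {R : realType} (e x : R) : 0 < e ->
  integrableR (fun y => poisson e (x - y)).
Proof.
move=> e0; apply/integrableP; split.
  by apply/measurable_EFinP; exact: measurable_poisson.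
under eq_integral => y _.
  rewrite gee0_abs; last by rewrite lee_fin poisson_ge0// ltW.
  over.
by rewrite integral_poisson// ltry.
Qed.

Lemma Rintegral_poisson {R : realType} (e x : R) : 0 < e ->
  \int[@lebesgue_measure R]_y poisson e (x - y) = pi.
Proof. by move=> e0; rewrite /Rintegral integral_poisson. Qed.

(* Away from the origin the Poisson kernel is at most [e] times a fixed
   integrable function, which replaces boundedness of [f]. *)
Lemma poisson_tail {R : realType} (e d t : R) : 0 < e -> 0 < d -> d <= `|t| ->
  poisson e t <= e * d ^- 2 /\
  poisson e t <= e * ((1 + d ^+ 2) / d ^+ 2 * poisson 1 t).
Proof.
move=> e0 d0 dt.
have dt2 : d ^+ 2 <= t ^+ 2 by rewrite -(real_normK (num_real t)) lerXn2r ?nnegrE// ltW.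
have d20 : 0 < d ^+ 2 by rewrite exprn_gt0.
have e20 : 0 < e ^+ 2 by rewrite exprn_gt0.
rewrite /poisson; split.
  by rewrite ler_pM2l// lef_pV2 ?posrE; lra.
rewrite ler_pM2l// expr1n mul1r ler_pdivlMr; last by lra.
rewrite ler_pdivlMr// -mulrA ler_pdivrMl; last by lra.
have : 0 <= e ^+ 2 * (1 + d ^+ 2) by rewrite mulr_ge0//; lra.
by lra.
Qed.

(** The error is the integral of [(f x - f y) * poisson e (x - y)]. For [|x - y| < d], continuity at
    [x] and the mass [pi] bound it by [eta / 2]; farther out the kernel is of order [e]. *)
Lemma poisson_approx {R : realType} (f : R -> R) (x : R) :
  integrableR f -> {for x, continuous f} ->
  \int[@lebesgue_measure R]_y (f y * poisson n.+1%:R^-1 (x - y)) @[n --> \oo] -->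
  pi * f x.
Proof.
move=> fi fx.
apply/cvgrPdist_le => eta eta0.
have pi0 := pi_gt0 R.
have eta1 : 0 < eta / (2 * pi) by rewrite divr_gt0// mulr_gt0.
have /nbhs_ballP[/= d d0 fd] : \forall y \near x, `|f x - f y| <= eta / (2 * pi).
  by move/cvgrPdist_le : fx => /(_ _ eta1).
(* Integrable majorant of the far part divided by [e]: each summand comes from one half of
   [poisson_tail], paired with [|f y|] and [|f x|] respectively. *)
pose G y := d ^- 2 * `|f y| + `|f x| * ((1 + d ^+ 2) / d ^+ 2) * poisson 1 (x - y).
have Gi : integrableR G.
  rewrite /integrableR.
  have -> : EFin \o G = ((fun y => (d ^- 2)%:E * (EFin \o (Num.norm \o f)) y) \+
      (fun y => (`|f x| * ((1 + d ^+ 2) / d ^+ 2))%:E *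
         (EFin \o (fun y => poisson 1 (x - y))) y))%E by [].
  apply: integrableD => //.
    by apply: integrableZl => //; exact: integrable_norm.
  by apply: integrableZl => //; exact: integrable_poisson.
pose B := \int[@lebesgue_measure R]_y G y.
have G0 y : 0 <= G y.
  apply: addr_ge0; first by rewrite mulr_ge0// invr_ge0 exprn_ge0// ltW.
  apply: mulr_ge0; last by rewrite poisson_ge0.
  by rewrite mulr_ge0// divr_ge0 ?exprn_ge0 ?addr_ge0 ?exprn_ge0 ?ltW.
have B0 : 0 <= B by exact: Rintegral_ge0.
have bound (e : R) : 0 < e ->
  `|pi * f x - \int[@lebesgue_measure R]_y (f y * poisson e (x - y))| <=
  eta / 2 + e * B.
  move=> e0.
  have pi_ := integrable_poisson e x e0.
  have mp := measurable_poisson e x e0.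
  have fpi : integrableR (fun y => f y * poisson e (x - y)).
    have /measurable_EFinP mf := measurable_int _ fi.
    have efi := integrableZl measurableT e^-1 fi.
    apply: (le_integrable measurableT _ _ efi).
      by apply/measurable_EFinP; exact: measurable_funM.
    move=> y _; rewrite /= lee_fin [X in X <= _]normrM.
    rewrite [X in _ <= X]normrM [X in _ <= X]mulrC.
    apply: ler_wpM2l => //.
    have P0 := poisson_ge0 e (x - y) (ltW e0).
    have eV0 : 0 < e^-1 by rewrite invr_gt0.
    by rewrite (ger0_norm P0) (gtr0_norm eV0) poisson_le.
  have -> : pi * f x = \int[@lebesgue_measure R]_y (f x * poisson e (x - y)).
    by rewrite RintegralZl// Rintegral_poisson// mulrC.
  have cpi : integrableR (fun y => f x * poisson e (x - y)).
    exact: (integrableZl _ (f x) pi_).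
  rewrite -RintegralB//.
  have di : integrableR (fun y => f x * poisson e (x - y) - f y * poisson e (x - y)).
    exact: (integrableB _ cpi fpi).
  apply: (le_trans (le_normr_Rintegral _ _)) => //.
  have -> : eta / 2 + e * B = \int[@lebesgue_measure R]_y
      (eta / (2 * pi) * poisson e (x - y) + e * G y).
    rewrite RintegralD//.
    - rewrite [X in _ = X + _]RintegralZl// Rintegral_poisson// RintegralZl//.
      congr (_ + _).
      by rewrite invfM mulrA divfK// gt_eqF.
    - exact: (integrableZl _ _ pi_).
    - exact: (integrableZl _ _ Gi).
  apply: le_Rintegral => //.
  - exact: integrable_norm.
  - apply: (integrableD _ (integrableZl _ _ pi_) (integrableZl _ _ Gi)) => //.
  - move=> y _; rewrite -mulrBl normrM (ger0_norm (poisson_ge0 _ _ (ltW e0))).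
    have P0 := poisson_ge0 _ (x - y) (ltW e0).
    have eG0 : 0 <= e * G y by rewrite mulr_ge0// ltW.
    have [xyd|xyd] := ltP `|x - y| d.
      apply: (@le_trans _ _ (eta / (2 * pi) * poisson e (x - y))); last by rewrite lerDl.
      by apply: ler_wpM2r => //; apply: fd.
    have [t1 t2] := poisson_tail _ _ _ e0 d0 xyd.
    apply: (@le_trans _ _ ((`|f x| + `|f y|) * poisson e (x - y))).
      by rewrite ler_wpM2r// ler_normB.
    rewrite mulrDl addrC -[X in X <= _]add0r lerD//.
      by rewrite mulr_ge0// ltW.
    rewrite /G mulrDr lerD//.
      by rewrite [X in _ <= X]mulrA [X in _ <= X]mulrC; apply: ler_wpM2l.
    rewrite (_ : e * _ = `|f x| * (e * ((1 + d ^+ 2) / d ^+ 2 * poisson 1 (x - y)))).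
      by apply: ler_wpM2l.
    by rewrite [LHS]mulrA [RHS]mulrCA !mulrA.
(* [B + 1] rather than [B], since [B] may be 0; this makes [e * B] at most [eta / 2]. *)
have B1 : 0 < eta / (2 * (B + 1)) by rewrite divr_gt0// mulr_gt0//; lra.
near=> n.
apply: (le_trans (bound n.+1%:R^-1 _)) => //.
have : n.+1%:R^-1 < eta / (2 * (B + 1)).
  near: n; exact: (near_infty_natSinv_lt (PosNum B1)).
have : 0 < n.+1%:R^-1 :> R by [].
move: (n.+1%:R^-1) => e e0 He.
move: He.
rewrite ltr_pdivlMr; last by lra.
by lra.
Unshelve. all: by end_near. Qed.

(** Insert the factor [expR (- e * w)] with [e = n.+1%:R^-1]. The damped integral tends to the left
    side by dominated convergence; by Fubini it is also a Poisson integral of [f], which tends to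
    [pi * f x]. *)
Lemma cos_inversion {R : realType} (f : R -> R) (x : R) :
  integrableR f -> {for x, continuous f} ->
  (forall w, \int[@lebesgue_measure R]_y (f y * sin (w * y)) = 0) ->
  integrableR (fun w => \int[@lebesgue_measure R]_y (f y * cos (w * y))) ->
  \int[@lebesgue_measure R]_(w in `[0, +oo[)
     (\int[@lebesgue_measure R]_y (f y * cos (w * y)) * cos (w * x)) = pi * f x.
Proof.
move=> fi fx sin0 ci.
set c := fun w => \int[@lebesgue_measure R]_y (f y * cos (w * y)) in ci *.
pose D : set (measurableTypeR R) := `[0%R, +oo[%classic.
have mD : measurable D by exact: measurable_itv.
have fci w : integrableR (fun y => f y * cos (w * y)).
  apply: integrable_mul_bounded => //; last by move=> y; exact: norm_cos_le1.
  by under eq_fun do rewrite mulrC; exact: measurable_cosM.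
have fsi w : integrableR (fun y => f y * sin (w * y)).
  apply: integrable_mul_bounded => //; last by move=> y; exact: norm_sin_le1.
  by under eq_fun do rewrite mulrC; exact: measurable_sinM.
(* The vanishing sine integrals supply the missing half of the addition formula for
   [cos (w * x - w * y)]. *)
have cE w : c w * cos (w * x) =
    \int[@lebesgue_measure R]_y (f y * cos (w * (x - y))).
  transitivity (\int[@lebesgue_measure R]_y
      (cos (w * x) * (f y * cos (w * y)) + sin (w * x) * (f y * sin (w * y)))).
    rewrite RintegralD//.
    - rewrite (RintegralZl _ measurableT (fci w)) (RintegralZl _ measurableT (fsi w)).
      by rewrite sin0 mulr0 addr0 mulrC.
    - exact: (integrableZl _ _ (fci w)).
    - exact: (integrableZl _ _ (fsi w)).
  by apply: eq_Rintegral => y _; rewrite mulrBr cosB; ring.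
have abel (e : R) : 0 < e ->
    \int[@lebesgue_measure R]_(w in D) (expR (- e * w) * (c w * cos (w * x))) =
    \int[@lebesgue_measure R]_y (f y * poisson e (x - y)).
  move=> e0.
  (* Extension by 0 off the half-line brings the integral into the whole-line form of
     [Rintegral_Fubini_cos]. *)
  pose h := (fun w => expR (- e * w)) \_ D.
  have hi : integrableR h.
    have := (integrable_mkcond _ mD).1 (integrable_expR_oppM e e0).
    by rewrite restrict_EFin.
  transitivity (\int[@lebesgue_measure R]_w
     (h w * \int[@lebesgue_measure R]_y (f y * cos (w * (x - y))))).
    rewrite Rintegral_mkcond; apply: eq_Rintegral => w _.
    by rewrite -cE /h !patchE; case: ifP => // _; rewrite mul0r.
  rewrite Rintegral_Fubini_cos//; apply: eq_Rintegral => y _; congr (_ * _).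
  rewrite -(Rintegral_expR_cos _ _ e0) [RHS]Rintegral_mkcond.
  by apply: eq_Rintegral => w _; rewrite /h !patchE; case: ifP => // _; rewrite mul0r.
have lim1 := poisson_approx f x fi fx.
have ciD : (@lebesgue_measure R).-integrable D (EFin \o (fun w => c w * cos (w * x))).
  apply: integrable_mul_bounded => //.
  - exact: (integrableS measurableT mD _ ci).
  - exact: measurable_cosM.
  - by move=> w; exact: norm_cos_le1.
have /measurable_EFinP mc := measurable_int _ ciD.
have mexp (e : R) : measurable_fun setT (fun w => expR (- e * w)).
  by apply: measurableT_comp => //; exact: mulrl_measurable.
have [] := @dominated_convergence _ _ _ (@lebesgue_measure R) D mD
  (fun n w => (expR (- n.+1%:R^-1 * w) * (c w * cos (w * x)))%:E)
  (fun w => (c w * cos (w * x))%:E) (fun w => `|(c w * cos (w * x))%:E|%E).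
- move=> n; apply/measurable_EFinP; apply: measurable_funM => //.
  by apply: measurable_funTS; exact: mexp.
- exact/measurable_EFinP.
- apply: aeW => w _; apply: cvg_EFin; first exact: nearW.
  rewrite -[X in _ --> X]mul1r; apply: cvgM; last exact: cvg_cst.
  rewrite -[X in _ --> X]expR0; apply: continuous_cvg; first exact: continuous_expR.
  rewrite -[X in _ --> X](mul0r w); apply: cvgM; last exact: cvg_cst.
  rewrite -[X in _ --> X]oppr0; apply: cvgN; exact: cvg_harmonic.
- exact: integrable_abse.
- apply: aeW => w n; rewrite /D/= in_itv/= andbT => w0.
  rewrite lee_fin [X in X <= _]normrM; apply: ler_piMl => //.
  rewrite ger0_norm ?expR_ge0// -[X in _ <= X]expR0 ler_expR mulNr oppr_le0.
  by rewrite mulr_ge0.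
move=> _ _; rewrite -[X in _ --> X]fineK; last exact: integrable_fin_num.
move=> /fine_cvg lim2.
apply: (cvg_unique _ _ lim1) => //.
apply: cvg_trans lim2; apply: near_eq_cvg; apply: nearW => n /=.
by rewrite -abel.
Qed.

(** * Second differences of cosine transforms *)

(** Minus one half of the central second difference of step [l]. *)
Definition sdiff {R : realType} (l : R) (f : R -> R) (x : R) : R :=
  f x - (f (x + l) + f (x - l)) / 2.

Lemma E_lin {R : realType} (phi : R -> R) n (l : R) (P Q : R -> R) (a c : R) :
  E_ phi n l P -> E_ phi n l Q -> E_ phi n l (fun x => a * P x + c * Q x).
Proof.
move=> [p Pp] [q Qq]; exists (fun k => a * p k + c * q k) => x.
rewrite Pp Qq !mulr_sumr -big_split/=; apply: eq_bigr => i _.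
by rewrite mulrDl !mulrA.
Qed.

(** The values 0, 1, 2 of [j] encode translation by [-l], 0, [l]; one additional node on each side
    leaves room for all three. *)
Lemma E_shift {R : realType} (phi : R -> R) n (l : R) (P : R -> R) (j : nat) :
  (j <= 2)%N -> E_ phi n l P ->
  E_ phi n.+1 l (fun x => P (x + l * (j%:R - 1))).
Proof.
move=> j2 [b Pb].
(* The coefficients are cut off outside [[-n, n]], where [b] is arbitrary. *)
exists (fun k => if `|k + 1 - j%:Z| <= n%:Z then b (k + 1 - j%:Z) else 0) => x.
rewrite Pb.
rewrite -(big_mkord xpredT (fun i => let k : int := i%:Z - n%:Z in
   b k * phi (x + l * (j%:R - 1) + l * k%:~R))).
rewrite -(big_mkord xpredT (fun i => let k : int := i%:Z - n.+1%:Z in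
   (if `|k + 1 - j%:Z| <= n%:Z then b (k + 1 - j%:Z) else 0) *
   phi (x + l * k%:~R))).
(* Of the [2 * n + 3] nodes, the first [j] and the last [2 - j] carry coefficient 0; the middle
   block is the original sum shifted by [j]. *)
rewrite [RHS](@big_cat_nat _ _ _ j)//=; last by lia.
rewrite [X in _ = X + _]big_nat_cond [X in _ = X + _]big1 ?add0r; last first.
  by move=> i; rewrite andbT => ij; rewrite ifF ?mul0r//; lia.
rewrite [RHS](@big_cat_nat _ _ _ (j + (2 * n).+1))//=; [|lia|lia].
rewrite [X in _ = _ + X]big_nat_cond [X in _ = _ + X]big1 ?addr0; last first.
  by move=> i; rewrite andbT => ij; rewrite ifF ?mul0r//; lia.
have reindex (F : nat -> R) : \sum_(j <= i < j + (2 * n).+1) F i =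
    \sum_(0 <= i < (2 * n).+1) F (i + j)%N.
  by rewrite -{1}[j]add0n big_addn addKn.
rewrite reindex; apply: eq_big_nat => i i2.
have -> : (i + j)%:Z - n.+1%:Z + 1 - j%:Z = i%:Z - n%:Z by lia.
rewrite ifT; last by lia.
congr (_ * phi _).
have -> : (i + j)%:Z - n.+1%:Z = i%:Z - n%:Z + (j%:Z - 1) by lia.
by rewrite !intrD !mulrNz; ring.
Qed.

Lemma E_sdiff {R : realType} (phi : R -> R) n (l : R) (P : R -> R) :
  E_ phi n l P -> E_ phi n.+1 l (sdiff l P).
Proof.
move=> EP.
have -> : sdiff l P = fun x => 1 * (P (x + l * (1%:R - 1))) + 1 *
   (- 2^-1 * P (x + l * (2%:R - 1)) + - 2^-1 * P (x + l * (0%:R - 1))).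
  apply/funext => x; rewrite /sdiff subrr mulr0 addr0 sub0r mulrN1.
  by rewrite (_ : 2 - 1 = 1 :> R) ?mulr1; [field | ring].
apply: E_lin; first exact: E_shift.
by apply: E_lin; apply: E_shift.
Qed.

Lemma E_iter_sdiff {R : realType} (phi : R -> R) (l : R) m :
  E_ phi m l (iter m (sdiff l) phi).
Proof.
elim: m => [|m IH]; last exact: E_sdiff.
by exists (fun=> 1) => x; rewrite big_ord1/= mulr0 addr0 mul1r.
Qed.

Definition cosT {R : realType} (g : R -> R) (x : R) : R :=
  \int[@lebesgue_measure R]_(w in `[0, +oo[) (g w * cos (w * x)).

Definition half_integrable {R : realType} (g : R -> R) : Prop :=
  (@lebesgue_measure R).-integrable `[0, +oo[ (EFin \o g).

Lemma half_integrable_cos {R : realType} (g : R -> R) (x : R) :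
  half_integrable g -> half_integrable (fun w => g w * cos (w * x)).
Proof.
move=> gi; apply: integrable_mul_bounded => //; first exact: measurable_cosM.
by move=> w; exact: norm_cos_le1.
Qed.

Lemma half_integrable_1Bcos {R : realType} (g : R -> R) (l : R) :
  half_integrable g -> half_integrable (fun w => g w * (1 - cos (w * l))).
Proof.
move=> gi; rewrite /half_integrable.
have -> : EFin \o (fun w => g w * (1 - cos (w * l))) =
   ((EFin \o g) \- (EFin \o (fun w => (g w * cos (w * l))%R)))%E.
  by apply/funext => w /=; rewrite mulrBr mulr1 EFinB.
by apply: integrableB => //; exact: half_integrable_cos.
Qed.

(** The average of [cos (w * (x + l))] and [cos (w * (x - l))] is [cos (w * x) * cos (w * l)], so
    the difference operator acts as a multiplier on the spectrum. *)
Lemma sdiff_cosT {R : realType} (g : R -> R) (l : R) : half_integrable g ->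
  sdiff l (cosT g) = cosT (fun w => g w * (1 - cos (w * l))).
Proof.
move=> gi; apply/funext => x.
have ci y := half_integrable_cos g y gi.
have si : (@lebesgue_measure R).-integrable `[0, +oo[
    (EFin \o (fun w => g w * cos (w * (x + l)) + g w * cos (w * (x - l)))).
  exact: (integrableD _ (ci _) (ci _)).
rewrite /sdiff /cosT -(RintegralD _ (ci _) (ci _))// mulrC.
rewrite -(RintegralZl _ _ si)// -(RintegralB _ (ci _) (integrableZl _ _ si))//.
apply: eq_Rintegral => w _; rewrite [w * (x + l)]mulrDr [w * (x - l)]mulrBr cosD cosB.
by field.
Qed.

Lemma iter_sdiff_cosT {R : realType} (g : R -> R) (l : R) m : half_integrable g ->
  half_integrable (fun w => g w * (1 - cos (w * l)) ^+ m) /\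
  iter m (sdiff l) (cosT g) = cosT (fun w => g w * (1 - cos (w * l)) ^+ m).
Proof.
move=> gi; elim: m => [|m [IHi IH]].
  by have -> : (fun w => g w * (1 - cos (w * l)) ^+ 0) = g
    by apply/funext => w; rewrite mulr1.
have -> : (fun w => g w * (1 - cos (w * l)) ^+ m.+1) =
    (fun w => (g w * (1 - cos (w * l)) ^+ m) * (1 - cos (w * l))).
  by apply/funext => w; rewrite exprSr mulrA.
split; first exact: half_integrable_1Bcos.
by rewrite iterS IH sdiff_cosT.
Qed.

Lemma cosT_even {R : realType} (g : R -> R) x : cosT g (- x) = cosT g x.
Proof. by apply: eq_Rintegral => w _; rewrite mulrN cosN. Qed.

Lemma norm_cosT {R : realType} (g : R -> R) x : half_integrable g ->
  (forall w, 0 <= g w) -> `|cosT g x| <= cosT g 0.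
Proof.
move=> gi g0.
apply: (le_trans (le_normr_Rintegral _ _)) => //; first exact: half_integrable_cos.
apply: le_Rintegral => //.
- exact/integrable_norm/half_integrable_cos.
- exact: half_integrable_cos.
- move=> w _; rewrite mulr0 cos0 mulr1 normrM (ger0_norm (g0 w)).
  by rewrite ler_piMr// norm_cos_le1.
Qed.

(** * Positive spectral mass and slow decay *)

(** A nonnegative function of zero integral vanishes almost everywhere. Without zeros just to the
    right of [x0], a nonempty open interval would lie in a null set. *)
Lemma clustering_zeros_of_Rintegral0 {R : realType} (g : R -> R) (a b x0 : R) :
  (@lebesgue_measure R).-integrable `[a, b] (EFin \o g) ->
  (forall w, 0 <= g w) ->
  \int[@lebesgue_measure R]_(w in `[a, b]) g w = 0 -> a <= x0 < b ->
  forall e : R, 0 < e -> exists x, [/\ x != x0, `|x - x0| < e & g x = 0].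
Proof.
move=> gi g0 Ig /andP[ax0 x0b] e e0; apply: contrapT => noz.
have mg := measurable_int (@lebesgue_measure R) gi.
have : (\int[@lebesgue_measure R]_(w in `[a, b]) `|(g w)%:E| = 0)%E.
  under eq_integral => w _ do rewrite gee0_abs ?lee_fin//.
  rewrite -[LHS]fineK; last exact: (integrable_fin_num _ gi).
  by rewrite -[X in X%:E]/(Rintegral _ _ _) Ig.
move/((@ae_eq_integral_abs _ _ _ (@lebesgue_measure R) _ (measurable_itv _) _ mg).1).
move=> [N [mN N0 subN]].
pose c := Num.min b (x0 + e).
have cb : c <= b by rewrite ge_min lexx.
have ce : c <= x0 + e by rewrite ge_min lexx orbT.
have x0c : x0 < c by rewrite lt_min x0b; lra.
have IN : `]x0, c[%classic `<=` N.
  move=> x /=; rewrite in_itv/= => /andP[x0x xc]; apply: subN => /= H; apply: noz.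
  exists x; split.
  - by rewrite gt_eqF.
  - by rewrite gtr0_norm; lra.
  - by apply: EFin_inj; apply: H; rewrite in_itv/=; apply/andP; split; lra.
have : (@lebesgue_measure R `]x0, c[%classic <= @lebesgue_measure R N)%E.
  by apply: le_measure => //; rewrite inE.
by rewrite N0 lebesgue_measure_itv/= lte_fin x0c -EFinB lee_fin subr_le0 leNgt x0c.
Qed.

Lemma cos_le0_middle {R : realType} (t : R) :
  pi / 2 <= t <= pi + pi / 2 -> cos t <= 0.
Proof.
move=> /andP[t1 t2].
have -> : t = (t - pi) + pi by rewrite subrK.
rewrite cosDpi oppr_le0; apply: cos_ge0_pihalf; move: (pi : R) t1 t2 => p t1 t2.
by apply/andP; split; lra.
Qed.

(** Otherwise every step from index 1 on would lose more than [3 / 4 * J], and the sequence would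
    fall below [J]. The index is kept positive because it becomes the [n] of the theorem. *)
Lemma slow_decay {R : realType} (M : nat -> R) (J : R) :
  0 < J -> (forall m, J <= M m) -> exists m, (0 < m)%N /\ M m / 4 <= M m.+1.
Proof.
move=> J0 JM; apply: contrapT => noM.
have dec m : M m.+2 < M m.+1 - 3 / 4 * J.
  have : M m.+2 < M m.+1 / 4.
    by rewrite ltNge; apply/negP => H; apply: noM; exists m.+1.
  by have := JM m.+1; lra.
have bnd m : M m.+1 <= M 1%N - 3 / 4 * J * m%:R.
  elim: m => [|m IH]; first by rewrite mulr0 subr0.
  rewrite -natr1; have := dec m; lra.
have M10 : 0 <= M 1%N / (3 / 4 * J).
  by rewrite divr_ge0//; [have := JM 1%N; lra | lra].
have := archi_boundP M10; rewrite ltr_pdivrMr; last by lra.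
have := bnd (Num.bound (M 1%N / (3 / 4 * J))).
have := JM (Num.bound (M 1%N / (3 / 4 * J))).+1.
by move: (_%:R) => n; lra.
Qed.

(** * From the complex Fourier transform to a cosine transform *)

Lemma Re_mulC {R : realType} (a : R) (z : R[i]) :
  complex.Re (real_complex R a * z) = a * complex.Re z.
Proof. by case: z => x y /=; rewrite mul0r subr0. Qed.

Lemma Im_mulC {R : realType} (a : R) (z : R[i]) :
  complex.Im (real_complex R a * z) = a * complex.Im z.
Proof. by case: z => x y /=; rewrite mul0r addr0. Qed.

Lemma Re_fourier {R : realType} (f : R -> R) (w : R) :
  complex.Re (fourier f w) = (Num.sqrt (2 * pi))^-1 *
    \int[@lebesgue_measure R]_x (f x * cos (w * x)).
Proof.
rewrite /fourier Re_mulC /integralC /=; congr (_ * _).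
by apply: eq_Rintegral => x _; rewrite mul0r subr0 cosN.
Qed.

Lemma Im_fourier {R : realType} (f : R -> R) (w : R) :
  complex.Im (fourier f w) = (Num.sqrt (2 * pi))^-1 *
    \int[@lebesgue_measure R]_x (f x * - sin (w * x)).
Proof.
rewrite /fourier Im_mulC /integralC /=; congr (_ * _).
by apply: eq_Rintegral => x _; rewrite mul0r addr0 sinN.
Qed.

(** With [s] the square root of [2 * pi], the cosine integral of [f] is [s] times the real part of
    its transform, and [cos_inversion] divided by [pi] gives [k = s / pi]. *)
Lemma fourier_cosT {R : realType} (f : R -> R) :
  integrableR f -> continuous f ->
  (forall w, 0 <= fourier f w) -> integrableC (fourier f) ->
  exists2 k : R, 0 < k &
    f = cosT (fun w => k * complex.Re (fourier f w)).
Proof.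
move=> fi fc hat0 [hati _].
have pi0 := pi_gt0 R.
pose s := Num.sqrt (2 * pi : R).
have s0 : 0 < s by rewrite sqrtr_gt0 mulr_gt0.
have ReE w : \int[@lebesgue_measure R]_x (f x * cos (w * x)) =
    s * complex.Re (fourier f w).
  by rewrite Re_fourier mulrA divff ?mul1r// gt_eqF.
have fsi w : integrableR (fun y => f y * sin (w * y)).
  apply: integrable_mul_bounded => //; last by move=> y; exact: norm_sin_le1.
  by under eq_fun do rewrite mulrC; exact: measurable_sinM.
(* In the order of [R[i]], [0 <= z] includes that [z] is real, so the sine integrals vanish. *)
have sin0 w : \int[@lebesgue_measure R]_x (f x * sin (w * x)) = 0.
  have : complex.Im (fourier f w) = 0.
    by have := hat0 w; rewrite lecE => /andP[/eqP].
  rewrite Im_fourier; under eq_Rintegral => x _ do rewrite mulrN -mulN1r.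
  rewrite (RintegralZl _ measurableT (fsi w)) mulN1r => /eqP.
  by rewrite mulf_eq0 invr_eq0 gt_eqF//= oppr_eq0 => /eqP.
exists (s / pi); first by rewrite divr_gt0.
apply/funext => x; apply: (@mulfI _ pi); first by rewrite gt_eqF.
have ci : integrableR (fun w => s * complex.Re (fourier f w)).
  exact: (integrableZl _ s hati).
have := cos_inversion f x fi (fc x) sin0.
have -> : (fun w => \int[@lebesgue_measure R]_y (f y * cos (w * y))) =
    (fun w => s * complex.Re (fourier f w)) by apply/funext.
move=> /(_ ci) <-.
rewrite /cosT -RintegralZl//; last first.
  apply: half_integrable_cos.
  apply: (integrableS measurableT) => //.
  exact: (integrableZl _ _ hati).
apply: eq_Rintegral => w _; rewrite ReE !mulrA; congr (_ * _ * _).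
by rewrite [pi * s]mulrC mulfK// gt_eqF.
Qed.

(** * Choice of the number of differences and conclusion *)

Theorem theorem1 (R : realType) (phi : R -> R)
  (phi_even : forall x, phi (- x) = phi x)
  (phi_cont : continuous phi)
  (phi_int : integrableR phi)
  (phi0 : phi 0 = 1)
  (phihat_ge0 : forall w, 0 <= fourier phi w)
  (phihat_int : integrableC (fourier phi))
  (phihat_analytic : analyticC (fourier phi))
  (lambda : R) (lambda_gt0 : 0 < lambda) :
  exists (n : nat) (P : R -> R),
    [/\ (0 < n)%N,
        E_ phi n lambda P,
        (0 < supnorm P)%E,
        (supnorm P < +oo)%E
      & ((pi ^+ 2 / 2 ^+ 10 / lambda)%:E <= deriv_supnorm P / supnorm P)%E].
Proof.
have [k k0 phiE] := fourier_cosT phi phi_int phi_cont phihat_ge0 phihat_int.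
pose g w := k * complex.Re (fourier phi w).
have g0 w : 0 <= g w.
  apply: mulr_ge0; first exact: ltW.
  by have := phihat_ge0 w; rewrite lecE => /andP[].
have gi : half_integrable g.
  apply: (integrableS measurableT) => //.
  have [hati _] := phihat_int.
  exact: (integrableZl _ k hati).
have pi0 := pi_gt0 R.
pose a := pi / 2 / lambda; pose b := (pi + pi / 2) / lambda.
have a0 : 0 < a by rewrite !divr_gt0.
have ab : a < b by rewrite ltr_pM2r ?invr_gt0//; lra.
have AD : `[a, b]%classic `<=` `[0, +oo[%classic.
  by move=> w /=; rewrite !in_itv/= andbT => /andP[aw _]; lra.
pose J := \int[@lebesgue_measure R]_(w in `[a, b]) g w.
have giA : (@lebesgue_measure R).-integrable `[a, b] (EFin \o g).
  by move: gi; apply: integrableS.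
have J0 : 0 < J.
  rewrite lt_neqAle Rintegral_ge0 ?andbT//; apply/eqP => JE.
  (* If [J = 0], the transform vanishes identically, and inversion contradicts [phi 0 = 1]. *)
  suff hat0 w : complex.Re (fourier phi w) = 0.
    have : phi 0 = 0.
      rewrite phiE /cosT; under eq_Rintegral => w _ do rewrite hat0 mulr0 mul0r.
      by rewrite Rintegral_cst// mul0r.
    by rewrite phi0 => /eqP; rewrite oner_eq0.
  apply: (analytic_zero_locus _ a phihat_analytic.1) => e e0.
  have [|x [xa xe gx]] := clustering_zeros_of_Rintegral0 g a b a giA g0 (esym JE) _ e e0.
    by rewrite lexx.
  exists x; split => //; apply/eqP; move/eqP: gx.
  by rewrite mulf_eq0 gt_eqF.
pose M m := iter m (sdiff lambda) phi 0.
have spec m := iter_sdiff_cosT g lambda m gi.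
pose gm m w := g w * (1 - cos (w * lambda)) ^+ m.
have gmi m : half_integrable (gm m) by case: (spec m).
have PE m : iter m (sdiff lambda) phi = cosT (gm m) by rewrite phiE; case: (spec m).
have gm0 m w : 0 <= gm m w.
  by rewrite mulr_ge0// exprn_ge0// subr_ge0 cos_le1.
have JM m : J <= M m.
  rewrite /M PE.
  apply: (@le_trans _ _ (\int[@lebesgue_measure R]_(w in `[a, b]) gm m w)).
    apply: le_Rintegral => //.
      by move: (gmi m); apply: integrableS.
    move=> w /=; rewrite in_itv/= ler_pdivrMr// ler_pdivlMr// => wab.
    rewrite ler_peMr// exprn_ege1//.
    by have := cos_le0_middle _ wab; lra.
  rewrite /cosT; under [X in _ <= X]eq_Rintegral => w _ do rewrite mulr0 cos0 mulr1.
  have fini (D : set R) : measurable (D : set (measurableTypeR R)) ->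
      D `<=` `[0, +oo[%classic ->
      (\int[@lebesgue_measure R]_(w in D) (gm m w)%:E \is a fin_num)%E.
    move=> mD DS; apply: integrable_fin_num => //.
    by move: (gmi m); apply: integrableS.
  rewrite /Rintegral fine_le ?fini//.
  apply: ge0_subset_integral => //.
    exact: measurable_int (gmi m).
  by move=> w _; rewrite lee_fin.
have [m [m0 Mm]] := slow_decay M J J0 JM.
have Mm0 : 0 < M m by exact: lt_le_trans (JM m).
set P := iter m (sdiff lambda) phi in Mm0.
exists m, P.
have supP : supnorm P = (M m)%:E.
  apply/eqP; rewrite eq_le; apply/andP; split.
    apply: ge_ereal_sup => _ [x _ <-]; rewrite lee_fin /M /P PE.
    by apply: norm_cosT.
  apply: ereal_sup_ubound; exists 0 => //.
  by rewrite -/(M m) gtr0_norm.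
rewrite supP; split => //; first exact: E_iter_sdiff.
  by rewrite ltry.
rewrite inver gt_eqF// lee_pdivlMr// leNgt; apply/negP.
(* If the claim fails, [P] is Lipschitz with constant [pi ^+ 2 / 2 ^+ 10 / lambda * M m]; this is
   tested on the points 0 and [lambda]. *)
rewrite -EFinM => /lipschitz_deriv_supnorm /(_ 0 lambda (ltW lambda_gt0)).
rewrite subr0 (_ : P 0 = M m)// => lip.
(* As a cosine transform [P] is even, so both neighbours of 0 contribute [P lambda]. *)
have MS : M m.+1 = M m - P lambda.
  rewrite {1}/M iterS /sdiff -/P add0r sub0r.
  have -> : P (- lambda) = P lambda by rewrite /P PE cosT_even.
  by rewrite (_ : M m = P 0)//; field.
(* This yields [pi ^+ 2 / 2 ^+ 10 < 16 / 1024 < 1 / 4], against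
   [M m / 4 <= M m.+1 = P 0 - P lambda]. *)
have pi4 : pi < 4 :> R by have := pihalf_lt2 R; lra.
have {lip} : M m / 4 <= pi ^+ 2 / 2 ^+ 10 * M m.
  have : pi ^+ 2 / 2 ^+ 10 / lambda * M m * lambda = pi ^+ 2 / 2 ^+ 10 * M m.
    by rewrite mulrAC divfK// gt_eqF.
  by move: lip; rewrite ler_norml => /andP[+ _] => H E; rewrite -E; lra.
rewrite mulrC ler_pM2r// ler_pdivlMr ?exprn_gt0//.
have : pi * pi < 4 * 4 :> R by apply: ltr_pM => //; exact: ltW.
by rewrite -expr2; move: (pi ^+ 2) => q; rewrite !exprS !expr0; lra.
Qed.
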